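(* For every $X\in ES$ and every pointed grand-coalition-first action $X$-model $(M,s)$, there is a pointed tree-like grand-coalition-first action $X$-model $(M',s')$ such that for all $\phi\in\Phi$: $\phi$ is true at $s$ in $M$ if and only if $\phi$ is true at $s'$ in $M'$.
   Context: Fix a countable set $AP$ of atomic propositions and a finite nonempty set $AG$ of agents. The language $\Phi$: $\phi ::= \top \mid p \mid \neg\phi \mid (\phi\wedge\phi) \mid \langle\langle C\rangle\rangle\phi$, $p\in AP$, $C\subseteq AG$. $ES=\{\epsilon,\mathtt S,\mathtt I,\mathtt D,\mathtt{SI},\mathtt{SD},\mathtt{ID},\mathtt{SID}\}$. For a nonempty set $AC$ and $C\subseteq AG$, $JA_C$ is the set of functions $\sigma_C:C\to AC$ ($JA_\emptyset=\{\emptyset\}$); $\sigma_C\subseteq\sigma_{AG}$ means $\sigma_C$ is the restriction of $\sigma_{AG}$ to $C$. A grand-coalition-first action model is $M=(ST,AC,out_{AG},L)$ with $ST,AC$ nonempty, $out_{AG}:ST\times JA_{AG}\to\mathcal P(ST)$, $L:ST\to\mathcal P(AP)$. For each $C$, $out_C(s,\sigma_C)=\bigcup\{out_{AG}(s,\sigma_{AG})\mid\sigma_C\subseteq\sigma_{AG}\}$ and $av_C(s)=\{\sigma_C\in JA_C\mid out_C(s,\sigma_C)\neq\emptyset\}$. Truth: $\top$ always; $p$ iff $p\in L(s)$; Boolean clauses as usual; $\langle\langle C\rangle\rangle\phi$ at $s$ iff some $\sigma_C\in av_C(s)$ has $\phi$ true at every $t\in out_C(s,\sigma_C)$. $M$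 is serial if $av_C(s)\neq\emptyset$ for all $C,s$; independent if for all $s$, disjoint $C,D$, $\sigma_C\in av_C(s)$, $\sigma_D\in av_D(s)$: $\sigma_C\cup\sigma_D\in av_{C\cup D}(s)$; deterministic if $out_{AG}(s,\sigma_{AG})$ is a singleton for all $s$ and $\sigma_{AG}\in av_{AG}(s)$. An $X$-model has the properties whose letters ($\mathtt S$, $\mathtt I$, $\mathtt D$) occur in $X$. For $C\subseteq AG$, a $C$-history from $s_0$ to $s_n$ is the sequence $(s_0)$ (when $s_n=s_0$) or $(s_0,\sigma^1,s_1,\dots,\sigma^n,s_n)$, $n\ge1$, with $\sigma^{i+1}\in av_C(s_i)$ and $s_{i+1}\in out_C(s_i,\sigma^{i+1})$. $M$ is tree-like if there is $r\in ST$ such that for every $s\in ST$ there is a unique $AG$-history from $r$ to $s$. *)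

(* Defs.v *)
From HB Require Import structures.
From mathcomp Require Import all_boot.
From mathcomp Require Import boolp classical_sets.

Set Implicit Arguments.
Unset Strict Implicit.
Unset Printing Implicit Defensive.

Local Open Scope classical_set_scope.

Inductive formula (AP : countType) (AG : finType) : Type :=
| Top
| Var (p : AP)
| Neg (phi : formula AP AG)
| And (phi psi : formula AP AG)
| Coal (C : {set AG}) (phi : formula AP AG).

(* The grand coalition AG, as a finite set (not a classical one). *)
Definition grand (AG : finType) : {set AG} := [set: AG]%SET.

(* The functions from C to AC; finite functions are extensional, and there is
   exactly one of them when C is empty. *)
Definition JA (AG : finType) (AC : Type) (C : {set AG}) : Type :=
  {ffun {a : AG | a \in C} -> AC}.

Definition restricts (AG : finType) (AC : Type) (C : {set AG})
    (sigma : JA AC C) (tau : JA AC (grand AG)) : Prop :=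
  forall a : {a : AG | a \in C},
    sigma a = tau (exist _ (val a) (finset.in_setT (val a))).

Lemma mem_setU_right (AG : finType) (C D : {set AG}) (a : AG) :
  a \in C :|: D -> a \notin C -> a \in D.
Proof. by rewrite inE => /orP[->|]. Qed.

(* On a common agent the left argument wins; only used for disjoint C, D. *)
Definition ja_union (AG : finType) (AC : Type) (C D : {set AG})
    (sigma : JA AC C) (tau : JA AC D) : JA AC (C :|: D) :=
  [ffun a : {a : AG | a \in C :|: D} =>
     match boolP (val a \in C) with
     | AltTrue aC => sigma (exist _ (val a) aC)
     | AltFalse aNC => tau (exist _ (val a) (mem_setU_right (valP a) aNC))
     end].

Lemma ja_unionl (AG : finType) (AC : Type) (C D : {set AG})
    (sigma : JA AC C) (tau : JA AC D) (a : AG)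
    (aU : a \in C :|: D) (aC : a \in C) :
  ja_union sigma tau (exist _ a aU) = sigma (exist _ a aC).
Proof.
rewrite ffunE /=; case: {-}_ / boolP => [h|/negP//].
by rewrite (bool_irrelevance h aC).
Qed.

Lemma ja_unionr (AG : finType) (AC : Type) (C D : {set AG})
    (sigma : JA AC C) (tau : JA AC D) (a : AG)
    (aU : a \in C :|: D) (aD : a \in D) :
  [disjoint C & D]%B -> ja_union sigma tau (exist _ a aU) = tau (exist _ a aD).
Proof.
move=> dCD; rewrite ffunE /=; case: {-}_ / boolP => [h|h].
  by have := disjointFr dCD h; rewrite aD.
by congr (tau (exist _ a _)); apply: bool_irrelevance.
Qed.

Record model (AP : countType) (AG : finType) : Type := Model {
  ST : Type;
  AC : Type;
  ST_nonempty : inhabited ST;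
  AC_nonempty : inhabited AC;
  out_AG : ST -> JA AC (grand AG) -> set ST;
  L : ST -> set AP
}.

Definition out (AP : countType) (AG : finType) (M : model AP AG)
    (C : {set AG}) (s : ST M) (sigma : JA (AC M) C) : set (ST M) :=
  \bigcup_(tau in [set tau | restricts sigma tau]) out_AG s tau.

Definition av (AP : countType) (AG : finType) (M : model AP AG)
    (C : {set AG}) (s : ST M) : set (JA (AC M) C) :=
  [set sigma | out s sigma !=set0].

Fixpoint sat (AP : countType) (AG : finType) (M : model AP AG) (s : ST M)
    (phi : formula AP AG) : Prop :=
  match phi with
  | Top => True
  | Var p => L s p
  | Neg psi => ~ sat s psi
  | And psi chi => sat s psi /\ sat s chi
  | Coal C psi =>
      exists2 sigma : JA (AC M) C, av s sigma &
        forall t : ST M, out s sigma t -> sat t psi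
  end.

Definition serial (AP : countType) (AG : finType) (M : model AP AG) : Prop :=
  forall (C : {set AG}) (s : ST M), av (C := C) s !=set0.

Definition independent (AP : countType) (AG : finType) (M : model AP AG) :
    Prop :=
  forall (s : ST M) (C D : {set AG})
    (sigma : JA (AC M) C) (tau : JA (AC M) D),
    [disjoint C & D]%B -> av s sigma -> av s tau -> av s (ja_union sigma tau).

Definition deterministic (AP : countType) (AG : finType) (M : model AP AG) :
    Prop :=
  forall (s : ST M) (sigma : JA (AC M) (grand AG)),
    av s sigma -> exists t : ST M, out_AG s sigma = [set t].

Inductive letter : Type := l_S | l_I | l_D.

Inductive ES : Type := X_eps | X_S | X_I | X_D | X_SI | X_SD | X_ID | X_SID.

Definition occurs (l : letter) (X : ES) : bool :=
  match l, X with
  | l_S, (X_S | X_SI | X_SD | X_SID) => true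
  | l_I, (X_I | X_SI | X_ID | X_SID) => true
  | l_D, (X_D | X_SD | X_ID | X_SID) => true
  | _, _ => false
  end.

Definition has_property (AP : countType) (AG : finType) (l : letter)
    (M : model AP AG) : Prop :=
  match l with
  | l_S => serial M
  | l_I => independent M
  | l_D => deterministic M
  end.

Definition X_model (AP : countType) (AG : finType) (X : ES)
    (M : model AP AG) : Prop :=
  forall l : letter, occurs l X -> has_property l M.

(* The C-history (s0, sigma1, s1, ..., sigman, sn) is represented by its start
   s0 together with the list of pairs (sigma1, s1), ..., (sigman, sn). *)
Fixpoint is_history (AP : countType) (AG : finType) (M : model AP AG)
    (C : {set AG}) (s : ST M) (h : seq (JA (AC M) C * ST M)) (t : ST M) :
    Prop :=
  match h with
  | [::] => t = s
  | (sigma, s') :: h' => [/\ av s sigma, out s sigma s' & is_history s' h' t]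
  end.

Definition tree_like (AP : countType) (AG : finType) (M : model AP AG) :
    Prop :=
  exists r : ST M, forall s : ST M,
    exists! h : seq (JA (AC M) (grand AG) * ST M), is_history r h s.

(* Main.v *)
(** Unravel [M] at [s]: the new states are the histories of the grand coalition
    from [s], each grand joint action prolonging a history by one step, and
    labels are read at the last state of a history.  The last-state map is a
    functional bisimulation which preserves and reflects the availability of
    every joint action, so truth and seriality, independence and determinism
    all carry over. *)

Require Import Defs.
From mathcomp Require Import all_boot.
From mathcomp Require Import boolp classical_sets.

Set Implicit Arguments.
Unset Strict Implicit.
Unset Printing Implicit Defensive.

Local Open Scope classical_set_scope.

Lemma restricts_grand (AG : finType) (AC : Type) (sigma tau : @JA AG AC (grand AG)) :
  restricts sigma tau <-> sigma = tau.
Proof.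
split=> [h|-> [a aG]]; last by congr (tau (exist _ a _)); apply: bool_irrelevance.
apply/ffunP => -[a aG]; rewrite h.
by congr (tau (exist _ a _)); apply: bool_irrelevance.
Qed.

Lemma out_grand (AP : countType) (AG : finType) (M : model AP AG) (s : ST M)
    (sigma : JA (Defs.AC M) (grand AG)) :
  out s sigma = out_AG s sigma.
Proof.
apply/seteqP; split=> t; first by case=> tau /restricts_grand ->.
by move=> st; exists sigma => //; apply/restricts_grand.
Qed.

(** [is_history] recurses from the start, whereas nodes grow at the end, so histories have to be
    split at their last step. Availability of [sigma] at [u] is absorbed by [out u sigma t'], which
    witnesses it. *)
Lemma is_history_rcons (AP : countType) (AG : finType) (M : model AP AG)
    (C : {set AG}) (h : seq (JA (Defs.AC M) C * ST M)) (s t t' : ST M)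
    (sigma : JA (Defs.AC M) C) :
  is_history s (rcons h (sigma, t')) t <->
  t = t' /\ exists2 u, is_history s h u & out u sigma t'.
Proof.
elim: h s => [|[tau v] h IH] s /=.
  split=> [[_ st' ->]|[-> [u -> ut']]]; first by split=> //; exists s.
  by split=> //; exists t'.
split=> [[avs sv /IH[-> [u hu ut']]]|[tt' [u [avs sv hu] ut']]].
  by split=> //; exists u.
by split=> //; apply/IH; split=> //; exists u.
Qed.

Section Unravelling.
Variables (AP : countType) (AG : finType) (M : model AP AG) (s : ST M).

Definition step : Type := JA (Defs.AC M) (grand AG) * ST M.

(** The default [s] makes the empty history end where it starts. *)
Definition last_state (h : seq step) : ST M := head s (unzip2 h).

(* Histories are stored with their most recent step first. *)
Fixpoint is_rev_history (h : seq step) : Prop :=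
  match h with
  | [::] => True
  | (sigma, t) :: h' => is_rev_history h' /\ out_AG (last_state h') sigma t
  end.

Definition node : Type := {h : seq step | is_rev_history h}.

Definition node_end (w : node) : ST M := last_state (sval w).

Definition root : node := exist is_rev_history [::] I.

(** Successors are found by comparing lists only: that the added step is a transition of [M] is part
    of the proof carried by [w']. *)
Definition unravelling : model AP AG :=
  @Model AP AG node (Defs.AC M) (inhabits root) (AC_nonempty M)
    (fun w sigma => [set w' | exists t, sval w' = (sigma, t) :: sval w])
    (fun w => L (node_end w)).

Lemma node_inj (w w' : node) : sval w = sval w' -> w = w'.
Proof. by case: w w' => [h p] [h' p'] /= e; apply: eq_exist. Qed.

Lemma out_AG_node_end (w w' : ST unravelling) (sigma : JA (Defs.AC M) (grand AG)) :
  out_AG w sigma w' -> out_AG (node_end w) sigma (node_end w').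
Proof. by case: w' => [h p] /= [t e]; subst h; case: p. Qed.

Lemma out_AG_node_lift (w : ST unravelling) (sigma : JA (Defs.AC M) (grand AG))
    (t : ST M) :
  out_AG (node_end w) sigma t ->
  exists2 w' : ST unravelling, out_AG w sigma w' & node_end w' = t.
Proof.
move=> wt; exists (exist is_rev_history ((sigma, t) :: sval w) (conj (svalP w) wt)).
  by exists t.
by [].
Qed.

Lemma out_node_end (C : {set AG}) (w w' : ST unravelling) (sigma : JA (Defs.AC M) C) :
  out w sigma w' -> out (node_end w) sigma (node_end w').
Proof. by case=> tau r ww'; exists tau => //; apply: out_AG_node_end. Qed.

Lemma out_node_lift (C : {set AG}) (w : ST unravelling) (sigma : JA (Defs.AC M) C)
    (t : ST M) :
  out (node_end w) sigma t ->
  exists2 w' : ST unravelling, out w sigma w' & node_end w' = t.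
Proof.
by case=> tau r /out_AG_node_lift[w' ww' <-]; exists w' => //; exists tau.
Qed.

(** Successors project along [node_end], and every transition of [M] lifts. Both models share their
    joint actions, so this is an equality of sets, and seriality and independence transfer by
    rewriting. *)
Lemma av_unravelling (C : {set AG}) (w : ST unravelling) :
  @av AP AG unravelling C w = @av AP AG M C (node_end w).
Proof.
apply/seteqP; split=> sigma [t].
  by move=> /out_node_end wt; exists (node_end t).
by move=> /out_node_lift[w' ww' _]; exists w'.
Qed.

Lemma sat_unravelling (phi : formula AP AG) (w : ST unravelling) :
  sat (node_end w) phi <-> sat w phi.
Proof.
elim: phi w => [|p|phi IH|phi IHphi psi IHpsi|C phi IH] w //=.
- by rewrite IH.
- by rewrite IHphi IHpsi.
- split=> -[sigma avs h]; exists sigma.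
  + by rewrite av_unravelling.
  + by move=> w' /out_node_end/h/IH.
  + by rewrite -av_unravelling.
  + by move=> t /out_node_lift[w' /h/IH + <-].
Qed.

Lemma serial_unravelling : serial M -> serial unravelling.
Proof. by move=> sM C w; rewrite av_unravelling; apply: sM. Qed.

Lemma independent_unravelling : independent M -> independent unravelling.
Proof. by move=> iM w C D sigma tau; rewrite !av_unravelling; apply: iM. Qed.

Lemma deterministic_unravelling : deterministic M -> deterministic unravelling.
Proof.
move=> dM w sigma; rewrite av_unravelling => /dM[t wE].
have [|w' ww' w't] := @out_AG_node_lift w sigma t; first by rewrite wE.
exists w'; apply/seteqP; split=> [v wv|v ->//].
have := out_AG_node_end wv; rewrite wE /= => vt.
(* Both successors prolong the list of [w] by [sigma] and a state, and both states equal [t]. *)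
apply: node_inj; case: ww' wv vt w't => [a wE'] [b vE].
by rewrite /node_end wE' vE /last_state /= => -> ->.
Qed.

Lemma X_model_unravelling (X : ES) : X_model X M -> X_model X unravelling.
Proof.
move=> XM l /XM; case: l.
- exact: serial_unravelling.
- exact: independent_unravelling.
- exact: deterministic_unravelling.
Qed.

(** The history visits the nodes given by the suffixes of the list of [w], shortest first. *)
Lemma history_to_node (w : ST unravelling) :
  exists h, @is_history AP AG unravelling (grand AG) root h w.
Proof.
case: w => h; elim: h => [|[sigma t] h IH] p.
  by exists [::]; apply: node_inj.
have [k kP] := IH (proj1 p).
exists (rcons k (sigma, exist is_rev_history _ p)); apply/is_history_rcons.
by split=> //; eexists; [exact: kP | rewrite out_grand; exists t].
Qed.

(** The list of a node records its last action and its predecessor, so the last step of any history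
    to it is forced; induct from the end. *)
Lemma history_to_node_inj (w : ST unravelling)
    (h k : seq (JA (Defs.AC unravelling) (grand AG) * ST unravelling)) :
  is_history (root : ST unravelling) h w ->
  is_history (root : ST unravelling) k w -> h = k.
Proof.
elim/last_ind: h w k => [|h [sigma v] IH] w k.
  move=> /= ->; case/lastP: k => [//|k [tau v]].
  (* A nonempty history back to the root would make the empty list of the root a cons. *)
  by move=> /is_history_rcons[<- [u _]]; rewrite out_grand => -[].
move=> /is_history_rcons[<- [u hu]]; rewrite out_grand => -[t wE].
case/lastP: k => [|k [tau v']]; first by move=> /= wr; rewrite wr in wE.
move=> /is_history_rcons[<- [u' ku']]; rewrite out_grand => -[t'].
rewrite wE => -[<- _ /node_inj uu'].
by rewrite -uu' in ku'; rewrite (IH _ _ hu ku').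
Qed.

Lemma tree_like_unravelling : tree_like unravelling.
Proof.
exists root => w; have [h hP] := history_to_node w.
by exists h; split=> // k; apply: history_to_node_inj.
Qed.

End Unravelling.

Theorem theorem7p1 (AP : countType) (AG : finType) (hAG : (0 < #|AG|)%N)
    (X : ES) (M : model AP AG) (s : ST M) (hM : X_model X M) :
  exists (M' : model AP AG) (s' : ST M'),
    [/\ X_model X M', tree_like M' &
        forall phi : formula AP AG, sat s phi <-> sat s' phi].
Proof.
exists (unravelling s), (root s); split.
- exact: X_model_unravelling.
- exact: tree_like_unravelling.
(* [node_end (root s)] computes to [s]. *)
- by move=> phi; apply: (sat_unravelling phi (root s)).
Qed.
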